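(* Let the connected network with $L\ge 2$ agents, the functions $f_i:\mathbb{R}^N\to\mathbb{R}$ ($i=1,\dots,L$), the constants $m_f, M_f$, the matrices $A, B, M_+, M_-$, and the notions of Q-linear and R-linear convergence be as in the context. In particular each $f_i$ is differentiable and satisfies, for all $\tilde x_a,\tilde x_b\in\mathbb{R}^N$, $\langle \nabla f_i(\tilde x_a)-\nabla f_i(\tilde x_b),\tilde x_a-\tilde x_b\rangle\ge m_{f_i}\|\tilde x_a-\tilde x_b\|_2^2$ with $m_{f_i}>0$ and $\|\nabla f_i(\tilde x_a)-\nabla f_i(\tilde x_b)\|_2\le M_{f_i}\|\tilde x_a-\tilde x_b\|_2$ with $M_{f_i}>0$. Consider the problem $$\min_{x\in\mathbb{R}^{LN},\,z\in\mathbb{R}^{2EN}} f(x)\quad\text{s.t. } Ax+Bz=0.$$ The primal variables $x$ and $z$ have unique optimal values $x^*$ and $z^*$, and the dual variable $\beta$ has a unique optimal value $\beta^*$ (i.e. a unique optimal multiplier, satisfying $\nabla f(x^* )+M_-\beta^*=0$) that lies in the column space of $M_-^T$. Let $c>0$ and let $(x^k,z^k,\beta^k)_{k\ge 0}$ be generated by the ADMM iteration: for all $k\ge 0$, $$\nabla f(x^{k+1})+M_-\beta^{k+1}-cM_+(z^k-z^{k+1})=0,\qquad \beta^{k+1}-\beta^k-\tfrac{c}{2}M_-^Tx^{k+1}=0,\qquad \tfrac12 M_+^Tx^k-z^k=0,$$ where $\beta$ is initialized such that $\beta^0$ lies in the column space of $M_-^T$. Put $u^k=[z^k;\beta^k]$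 and $u^*=[z^*;\beta^*]$. Then for any $\mu>1$, $u^k$ is Q-linearly convergent to its optimal $u^*$ with respect to the $G$-norm, with $$\|u^{k+1}-u^*\|_G^2\le\frac{1}{1+\delta}\|u^k-u^*\|_G^2,$$ where $$\delta=\min\left\{\frac{(\mu-1)\tilde\sigma_{\min}^2(M_-)}{\mu\,\sigma_{\max}^2(M_+)},\ \frac{m_f}{\frac{c}{4}\sigma_{\max}^2(M_+)+\frac{\mu}{c}M_f^2\tilde\sigma_{\min}^{-2}(M_-)}\right\}>0.$$ Further, $x^k$ is R-linearly convergent to $x^*$, following from $$\|x^{k+1}-x^*\|_2^2\le\frac{1}{m_f}\|u^k-u^*\|_G^2.$$
   Context: Network: a connected undirected simple graph with vertex set $\{1,\dots,L\}$ ($L\ge 2$ agents) and $E$ edges. Replacing each edge by its two opposite arcs gives the arc set $\mathcal{A}$ with $|\mathcal{A}|=2E$ (so $(i,j)\in\mathcal{A}$ iff $(j,i)\in\mathcal{A}$ iff $i,j$ are adjacent). Fix an enumeration of $\mathcal{A}$. Variables: $x=[x_1;\dots;x_L]\in\mathbb{R}^{LN}$ with blocks $x_i\in\mathbb{R}^N$; $z\in\mathbb{R}^{2EN}$ is the concatenation of blocks $z_{ij}\in\mathbb{R}^N$, $(i,j)\in\mathcal{A}$; $\beta\in\mathbb{R}^{2EN}$. Semicolons denote vertical concatenation. Objective: $f(x)=\sum_{i=1}^L f_i(x_i)$, with $m_f=\min_i m_{f_i}$ and $M_f=\max_i M_{f_i}$, where $m_{f_i}$ and $M_{f_i}$ are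 the strong convexity and gradient-Lipschitz constants of $f_i$. Matrices: $A_1,A_2\in\mathbb{R}^{2EN\times LN}$ consist of $2E\times L$ blocks of size $N\times N$. If the $q$th block of $z$ is $z_{ij}$ (i.e. the $q$th arc is $(i,j)$), then the $(q,i)$th block of $A_1$ and the $(q,j)$th block of $A_2$ are the identity $I_N$; all other blocks are zero. $A=[A_1;A_2]$, $B=[-I_{2EN};-I_{2EN}]$, so that $Ax+Bz=0$ means $x_i=z_{ij}$ and $x_j=z_{ij}$ for all $(i,j)\in\mathcal{A}$. $M_+=A_1^T+A_2^T$ and $M_-=A_1^T-A_2^T$. The optimality (KKT) conditions for the problem $\min f(x)$ s.t. $Ax+Bz=0$ are: $\nabla f(x^* )+M_-\beta^*=0$, $M_-^Tx^*=0$, $\frac12M_+^Tx^*-z^*=0$; an optimal multiplier is a vector $\beta^*$ satisfying these together with the primal optimal solution $(x^*,z^* )$. $\sigma_{\max}(\cdot)$ denotes the largest singular value and $\tilde\sigma_{\min}(\cdot)$ the smallest nonzero singular value of a matrix. The $G$-norm of $u=[z;\beta]$ is $\|u\|_G=\sqrt{u^TGu}$ with $G=\begin{pmatrix} cI_{2EN} & 0\\ 0 & \frac1c I_{2EN}\end{pmatrix}$, i.e. $\|u\|_G^2=c\|z\|_2^2+\frac1c\|\beta\|_2^2$. Convergence notions: a sequence $y^k$ Q-linearly converges to a point $y^*$ (with respect to a vector norm $\|\cdot\|$) if there exists a number $\rho\in(0,1)$ such that $\lim_{k\to\infty}\frac{\|y^{k+1}-y^*\|}{\|y^k-y^*\|}=\rho$.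 A sequence $x^k$ R-linearly converges to a point $x^*$ if for all $k$, $\|x^k-x^*\|\le\|y^k-y^*\|$, where $y^k$ Q-linearly converges to $y^*$.
   Formalization: The error ratios of u^k may have no limit (or be 0/0), so Q-linear convergence in the limit sense is claimed only when u^0≠u* and the ratios converge; a uniform bound ‖u^{k+1}-u*‖_G ≤ ρ‖u^k-u*‖_G with ρ in (0,1) is claimed unconditionally. *)

(* Defs.v *)
(* MathComp / MathComp-Analysis, over an arbitrary R : realType. *)
From HB Require Import structures.
From mathcomp Require Import all_boot all_order all_algebra.
From mathcomp Require Import all_classical all_reals all_analysis.

Set Implicit Arguments.
Unset Strict Implicit.
Unset Printing Implicit Defensive.

Import Order.TTheory GRing.Theory Num.Theory.
Import numFieldNormedType.Exports.

Local Open Scope classical_set_scope.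
Local Open Scope ring_scope.

Definition norm2 (R : realType) (n : nat) (x : 'cV[R]_n) : R :=
  Num.sqrt (\sum_i x i 0 ^+ 2).

Definition dotp (R : realType) (n : nat) (x y : 'cV[R]_n) : R :=
  \sum_i x i 0 * y i 0.

Definition grad (R : realType) (n : nat) (f : 'cV[R]_n -> R) (x : 'cV[R]_n) :
    'cV[R]_n :=
  \col_i 'D_(delta_mx i 0) f x.

Definition strongly_monotone_grad (R : realType) (n : nat) (m : R)
    (f : 'cV[R]_n -> R) : Prop :=
  forall a b, m * norm2 (a - b) ^+ 2 <= dotp (grad f a - grad f b) (a - b).

Definition lipschitz_grad (R : realType) (n : nat) (M : R)
    (f : 'cV[R]_n -> R) : Prop :=
  forall a b, norm2 (grad f a - grad f b) <= M * norm2 (a - b).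

(* [eigenvalue] refers to row eigenvectors; [M^T *m M] is symmetric. *)
Definition singular_value (R : realType) (m n : nat) (M : 'M[R]_(m, n))
    (s : R) : Prop :=
  0 <= s /\ eigenvalue (M^T *m M) (s ^+ 2).

(* The sets below are finite, so [sup] and [inf] are a maximum and a minimum
   whenever the sets are nonempty. *)
Definition sigma_max (R : realType) (m n : nat) (M : 'M[R]_(m, n)) : R :=
  sup [set s | singular_value M s].

Definition sigma_min_nz (R : realType) (m n : nat) (M : 'M[R]_(m, n)) : R :=
  inf [set s | singular_value M s /\ s != 0].

Definition in_colspace (R : realType) (m n : nat) (M : 'M[R]_(m, n))
    (v : 'cV[R]_m) : Prop :=
  exists w : 'cV[R]_n, v = M *m w.

(* [arc] lists every arc of the graph [e] exactly once. Having [2 * E] of them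
   says that [e], symmetric and irreflexive, has [E] edges. *)
Definition arc_enumeration (L E : nat) (e : rel 'I_L)
    (arc : 'I_(2 * E) -> 'I_L * 'I_L) : Prop :=
  injective arc /\ forall i j, e i j <-> exists q, arc q = (i, j).

(* A vector made of [k] blocks of size [N]; the [i]-th block of [x] is
   [submxcol x i]. *)
Notation blockV R k N := 'cV[R]_(\sum_(i < k) N).

Notation blockM R k l N := 'M[R]_(\sum_(i < k) N, \sum_(j < l) N).

Definition sum_obj (R : realType) (L N : nat) (fi : 'I_L -> 'cV[R]_N -> R)
    (x : blockV R L N) : R :=
  \sum_i fi i (submxcol x i).

Section Network.
Variables (R : realType) (L E N : nat) (arc : 'I_(2 * E) -> 'I_L * 'I_L).

Definition A1 : blockM R (2 * E) L N :=
  \mxblock_(q, i) (if (arc q).1 == i then 1%:M else 0 : 'M[R]_N).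

Definition A2 : blockM R (2 * E) L N :=
  \mxblock_(q, j) (if (arc q).2 == j then 1%:M else 0 : 'M[R]_N).

Definition matA := col_mx A1 A2.

Definition matB := col_mx (- 1%:M) (- 1%:M) :
  'M[R]_(\sum_(q < 2 * E) N + \sum_(q < 2 * E) N, \sum_(q < 2 * E) N).

Definition Mplus := A1^T + A2^T.

Definition Mminus := A1^T - A2^T.

Definition primal_optimal (f : blockV R L N -> R)
    (x : blockV R L N) (z : blockV R (2 * E) N) : Prop :=
  matA *m x + matB *m z = 0 /\
  forall x' z', matA *m x' + matB *m z' = 0 -> f x <= f x'.

Definition KKT (f : blockV R L N -> R) (x : blockV R L N)
    (z beta : blockV R (2 * E) N) : Prop :=
  [/\ grad f x + Mminus *m beta = 0,
      Mminus^T *m x = 0 &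
      2^-1 *: (Mplus^T *m x) - z = 0].

Definition ADMM (f : blockV R L N -> R) (c : R) (x : nat -> blockV R L N)
    (z beta : nat -> blockV R (2 * E) N) : Prop :=
  forall k,
  [/\ grad f (x k.+1) + Mminus *m beta k.+1
        - c *: (Mplus *m (z k - z k.+1)) = 0,
      beta k.+1 - beta k - (c / 2) *: (Mminus^T *m x k.+1) = 0 &
      2^-1 *: (Mplus^T *m x k) - z k = 0].

Definition delta (c mu m M : R) : R :=
  Num.min
    ((mu - 1) * sigma_min_nz Mminus ^+ 2 / (mu * sigma_max Mplus ^+ 2))
    (m / (c / 4 * sigma_max Mplus ^+ 2
          + mu / c * M ^+ 2 * sigma_min_nz Mminus ^- 2)).

End Network.

Definition Gnorm (R : realType) (n : nat) (c : R) (u : 'cV[R]_(n + n)) : R :=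
  Num.sqrt ((u^T *m block_mx c%:M 0 0 (c^-1)%:M *m u) 0 0).

Definition err_ratio (R : realType) (n : nat) (nu : 'cV[R]_n -> R)
    (y : nat -> 'cV[R]_n) (ys : 'cV[R]_n) (k : nat) : R :=
  nu (y k.+1 - ys) / nu (y k - ys).

(* Since [_ / 0 = 0], a positive limit forces [nu (y k - ys) != 0] for all
   large k. *)
Definition Q_linear (R : realType) (n : nat) (nu : 'cV[R]_n -> R)
    (y : nat -> 'cV[R]_n) (ys : 'cV[R]_n) : Prop :=
  exists2 rho : R, 0 < rho < 1 & err_ratio nu y ys @ \oo --> rho.

(* Unlike [Q_linear], this needs neither nonzero errors nor a limit of the error
   ratios. For the ADMM iteration these ratios need not converge: they
   oscillate already for L = 2, N = 1, c = 1 and f_1(t) = 3 t^2 / 2,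
   f_2(t) = t^2 / 2. *)
Definition Q_linear_bound (R : realType) (n : nat) (nu : 'cV[R]_n -> R)
    (y : nat -> 'cV[R]_n) (ys : 'cV[R]_n) : Prop :=
  exists2 rho : R, 0 < rho < 1 &
    forall k, nu (y k.+1 - ys) <= rho * nu (y k - ys).

Definition vector_norm (R : realType) (n : nat) (nu : 'cV[R]_n -> R) : Prop :=
  [/\ forall u v, nu (u + v) <= nu u + nu v,
      forall a u, nu (a *: u) = `|a| * nu u &
      forall u, nu u = 0 -> u = 0].

Definition R_linear (R : realType) (n : nat) (nu : 'cV[R]_n -> R)
    (x : nat -> 'cV[R]_n) (xs : 'cV[R]_n) : Prop :=
  exists (p : nat) (nu' : 'cV[R]_p -> R) (y : nat -> 'cV[R]_p) (ys : 'cV[R]_p),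
    [/\ vector_norm nu', Q_linear nu' y ys &
        forall k, nu (x k - xs) <= nu' (y k - ys)].

(* Main.v *)
(* With [g], [d], [Z_k], [B_k] the errors of the gradient, of [x], [z] and
   [beta], one iteration reads [g + M_- B_1 = c M_+ (Z_0 - Z_1)],
   [M_+^T d = 2 Z_1], [M_-^T d = (2/c) (B_1 - B_0)]. Pairing the first equation
   with [d] gives [|u_0|_G^2 = |u_1|_G^2 + |u_0 - u_1|_G^2 + <g, d>], and
   [delta |u_1|_G^2 <= |u_0 - u_1|_G^2 + m_f |d|^2]: the [z]-part of the left
   side is bounded by [d] through [M_+^T], the [beta]-part through the first
   equation, because [B_1] lies in the column space of [M_-^T].
   Conversely [|u_0|_G <= K |u_1|_G]: by strong monotonicity [d] is controlled
   by [Z_1] and [B_1] (even if [M_+^T] is singular, as for bipartite graphs),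
   and then so are [Z_0] and [B_0]. Hence the error ratios cannot tend to 0.
   A KKT point comes from minimizing [f] over the kernel of [M_-^T]: the gradient
   at the minimizer is orthogonal to that kernel. Apart from a proper arc, which
   makes [M_-] and [M_+] nonzero, the structure of the graph plays no role. *)
Require Import Defs.
From HB Require Import structures.
From mathcomp Require Import all_boot all_order all_algebra.
From mathcomp Require Import all_classical all_reals all_analysis.
From mathcomp Require Import ring lra.
Import Order.TTheory GRing.Theory Num.Theory.
Import numFieldNormedType.Exports.
Local Open Scope classical_set_scope.
Local Open Scope ring_scope.
Set Implicit Arguments.
Unset Strict Implicit.

(** * Euclidean inner product, Young's inequality, orthogonality to a kernel *)

Section InnerProduct.
Variable R : realType.
Implicit Types n m : nat.

Lemma dotpE n (x y : 'cV[R]_n) : dotp x y = (x^T *m y) 0 0.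
Proof. by rewrite mxE; apply: eq_bigr => i _; rewrite mxE. Qed.

Lemma dotpC n (x y : 'cV[R]_n) : dotp x y = dotp y x.
Proof. by apply: eq_bigr => i _; rewrite mulrC. Qed.

Lemma dotpDr n (x y z : 'cV[R]_n) : dotp x (y + z) = dotp x y + dotp x z.
Proof. by rewrite !dotpE mulmxDr mxE. Qed.

Lemma dotpZr n a (x y : 'cV[R]_n) : dotp x (a *: y) = a * dotp x y.
Proof. by rewrite !dotpE -scalemxAr mxE. Qed.

Lemma dotpNr n (x y : 'cV[R]_n) : dotp x (- y) = - dotp x y.
Proof. by rewrite -scaleN1r dotpZr mulN1r. Qed.

Lemma dotp0r n (x : 'cV[R]_n) : dotp x 0 = 0.
Proof. by rewrite -(scale0r 0) dotpZr mul0r. Qed.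

Lemma dotpDl n (x y z : 'cV[R]_n) : dotp (y + z) x = dotp y x + dotp z x.
Proof. by rewrite !(dotpC _ x) dotpDr. Qed.

Lemma dotpZl n a (x y : 'cV[R]_n) : dotp (a *: y) x = a * dotp y x.
Proof. by rewrite !(dotpC _ x) dotpZr. Qed.

Lemma dotpNl n (x y : 'cV[R]_n) : dotp (- y) x = - dotp y x.
Proof. by rewrite !(dotpC _ x) dotpNr. Qed.

Definition dotp_lin := (dotpDl, dotpDr, dotpNl, dotpNr, dotpZl, dotpZr).

Lemma dotp_mulmx n m (A : 'M[R]_(m, n)) (x : 'cV[R]_n) (y : 'cV[R]_m) :
  dotp (A *m x) y = dotp x (A^T *m y).
Proof. by rewrite !dotpE trmx_mul mulmxA. Qed.

Lemma dotp_mulmx_trmx n m (A : 'M[R]_(m, n)) (x : 'cV[R]_n) (y : 'cV[R]_m) :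
  dotp (A^T *m y) x = dotp y (A *m x).
Proof. by rewrite dotp_mulmx trmxK. Qed.

Lemma dotp_delta n (x : 'cV[R]_n) i : dotp x (delta_mx i 0) = x i 0.
Proof.
rewrite /dotp (bigD1 i)//= mxE !eqxx mulr1 big1 ?addr0// => j ji.
by rewrite mxE (negbTE ji) mulr0.
Qed.

Lemma dotp_inj n (x y : 'cV[R]_n) :
  (forall v, dotp x v = dotp y v) -> x = y.
Proof. by move=> xy; apply/colP => i; rewrite -!dotp_delta xy. Qed.

Lemma dotp_ge0 n (x : 'cV[R]_n) : 0 <= dotp x x.
Proof. by apply: sumr_ge0 => i _; rewrite -expr2 sqr_ge0. Qed.

Lemma dotp_eq0 n (x : 'cV[R]_n) : dotp x x = 0 -> x = 0.
Proof.
move=> x0; apply/colP => i; rewrite mxE; apply/eqP.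
rewrite -sqrf_eq0 expr2; apply/eqP.
by apply: (psumr_eq0P _ x0) => // j _; rewrite -expr2 sqr_ge0.
Qed.

Lemma dotp_gt0 n (x : 'cV[R]_n) : x != 0 -> 0 < dotp x x.
Proof.
by move=> x0; rewrite lt0r dotp_ge0 andbT; apply: contraNneq x0 => /dotp_eq0 ->.
Qed.

Lemma norm2_sqr n (x : 'cV[R]_n) : norm2 x ^+ 2 = dotp x x.
Proof.
rewrite sqr_sqrtr; last by apply: sumr_ge0 => i _; rewrite sqr_ge0.
by apply: eq_bigr => i _; rewrite expr2.
Qed.

Lemma dotp_le_sqr n p (M : R) (x : 'cV[R]_n) (y : 'cV[R]_p) :
  norm2 x <= M * norm2 y -> dotp x x <= M ^+ 2 * dotp y y.
Proof.
move=> xy; rewrite -!norm2_sqr -exprMn; apply: lerXn2r => //.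
- exact: sqrtr_ge0.
- by rewrite nnegrE (le_trans _ xy)// sqrtr_ge0.
Qed.

Lemma dotp_young n (t : R) (x y : 'cV[R]_n) : 0 < t ->
  2 * dotp x y <= t * dotp x x + t^-1 * dotp y y.
Proof.
move=> t0; have := dotp_ge0 (t *: x - y); rewrite !dotp_lin (dotpC y x) => h.
rewrite -(ler_pM2l t0) mulrDr (mulrA t t^-1) mulfV ?gt_eqF// mul1r.
by nra.
Qed.

Lemma dotp_addl_le n (x y : 'cV[R]_n) :
  dotp (x + y) (x + y) <= 2 * dotp x x + 2 * dotp y y.
Proof. by have := dotp_ge0 (x - y); rewrite !dotp_lin (dotpC y x); lra. Qed.

Lemma gramx_eq0 n m (A : 'M[R]_(m, n)) (x : 'cV[R]_n) :
  A^T *m A *m x = 0 -> A *m x = 0.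
Proof.
by move=> Ax0; apply: dotp_eq0; rewrite dotp_mulmx mulmxA Ax0 dotp0r.
Qed.

Lemma gramx_sym n m (A : 'M[R]_(m, n)) : (A^T *m A)^T = A^T *m A.
Proof. by rewrite trmx_mul trmxK. Qed.

(* The Fredholm alternative, with [A^T *m A] in place of [A^T]. *)
Lemma ortho_ker_colspace n m (A : 'M[R]_(m, n)) (g : 'cV[R]_n) :
  (forall v, A *m v = 0 -> dotp g v = 0) ->
  exists w, g = A^T *m A *m w.
Proof.
move=> gA; set S := A^T *m A.
have : (g^T <= S)%MS.
  rewrite submxE; apply/eqP/rowP => j; rewrite [RHS]mxE.
  have -> : (g^T *m cokermx S) 0 j = dotp g (col j (cokermx S)).
    by rewrite dotpE colE (mulmxA _ _ (delta_mx j 0)) -colE [RHS]mxE.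
  rewrite gA// ; apply: gramx_eq0.
  by rewrite colE (mulmxA _ _ (delta_mx j 0)) mulmx_coker mul0mx.
case/submxP => w gw; exists w^T; apply: trmx_inj.
by rewrite gw trmx_mul trmxK gramx_sym.
Qed.

End InnerProduct.

(** * Continuity of quadratic forms and attainment of minima *)

Section Continuity.
Variable R : realType.
Implicit Types n m : nat.

Lemma trmx_continuous m n : continuous (@trmx R m n).
Proof.
move=> x s /= /(nbhs_ballP x^T) [e e0 es].
apply/nbhs_ballP; exists e => // y [_ xy]; apply: es; split => // i j.
by rewrite !mxE.
Qed.

Lemma sum_continuous (T : topologicalType) (I : Type) (r : seq I)
    (F : I -> T -> R) :
  (forall i, continuous (F i)) -> continuous (fun x => \sum_(i <- r) F i x).
Proof.
move=> cF; elim: r => [|i r IH] x.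
  have -> : (fun x => \sum_(i <- [::]) F i x) = fun=> 0.
    by apply/funext => y; rewrite big_nil.
  exact: cst_continuous.
have -> : (fun x => \sum_(j <- i :: r) F j x) =
    fun x => F i x + \sum_(j <- r) F j x.
  by apply/funext => y; rewrite big_cons.
by apply: continuousD; [exact: cF|exact: IH].
Qed.

Lemma dotp_mulmx_continuous n (S : 'M[R]_n) :
  continuous (fun x : 'cV[R]_n => dotp x (S *m x)).
Proof.
apply: sum_continuous => i x.
apply: continuousM; first exact: coord_continuous.
have -> : (fun x : 'cV[R]_n => (S *m x) i 0) = fun x => \sum_j S i j * x j 0.
  by apply/funext => y; rewrite mxE.
apply: sum_continuous => j {}x; apply: continuousM; first exact: cst_continuous.
exact: coord_continuous.
Qed.

(** A Euclidean bound controls every coordinate, so transposing [A] gives a closed and bounded,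
    hence compact, set of row vectors. *)
Lemma compact_EVT_min_cV n (f : 'cV[R]_n -> R) (A : set 'cV[R]_n) (r : R) :
  continuous f -> closed A -> A !=set0 -> (forall x, A x -> dotp x x <= r) ->
  exists2 c, A c & forall x, A x -> f c <= f x.
Proof.
move=> cf cA [x0 Ax0] Ar.
pose B := [set v : 'rV[R]_n | A v^T].
have cB : compact B.
  apply: bounded_closed_compact; last first.
    by apply: (@preimage_closed _ _ trmx A) => // x _; apply: trmx_continuous.
  exists (r + 1); split; first exact: num_real.
  move=> s rs v Bv.
  rewrite /= [leLHS]/Num.norm/= mx_normrE; apply/bigmax_leP; split.
    apply: ltW; apply: le_lt_trans rs; apply: addr_ge0 => //.
    exact: le_trans (dotp_ge0 _) (Ar _ Ax0).
  move=> -[i j] _ /=; rewrite ord1.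
  have: v 0 j ^+ 2 <= r.
    apply: le_trans (Ar _ Bv); rewrite /dotp (bigD1 j)//= !mxE expr2 lerDl.
    by apply: sumr_ge0 => k _; rewrite -expr2 sqr_ge0.
  rewrite -real_normK ?num_real// => h; have := normr_ge0 (v 0 j).
  by nra.
have B0 : B !=set0 by exists x0^T; rewrite /B /= trmxK.
have [|c cB' cmin] := @compact_EVT_min _ _ (f \o trmx) B B0 cB.
  by apply: continuous_subspaceT => x; apply: continuous_comp;
    [apply: trmx_continuous|apply: cf].
exists c^T; first by move: cB'; rewrite inE.
by move=> x Ax; rewrite -[x]trmxK; apply: cmin; rewrite inE /B/= trmxK.
Qed.

Lemma closed_ker m n (A : 'M[R]_(m, n)) : closed [set x : 'cV[R]_n | A *m x = 0].
Proof.
have -> : [set x : 'cV[R]_n | A *m x = 0] =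
    (fun x => dotp x (A^T *m A *m x)) @^-1` [set 0].
  apply/seteqP; split => x /=; first by rewrite -mulmxA => ->; rewrite mulmx0 dotp0r.
  by rewrite -mulmxA -dotp_mulmx => /dotp_eq0.
by apply: preimage_closed => [x _|]; [apply: dotp_mulmx_continuous|apply: closed_eq].
Qed.

Lemma dotp_continuous n : continuous (fun x : 'cV[R]_n => dotp x x).
Proof.
have -> : (fun x : 'cV[R]_n => dotp x x) = fun x => dotp x (1%:M *m x).
  by apply/funext => x; rewrite mul1mx.
exact: dotp_mulmx_continuous.
Qed.

End Continuity.

(** * Gradients, strong monotonicity, and minimization over a kernel *)

Section Gradient.
Variables (R : realType) (n : nat) (f : 'cV[R]_n -> R).
Hypothesis df : forall x, differentiable f x.

Lemma derive_grad x v : 'D_v f x = dotp (grad f x) v.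
Proof.
rewrite deriveE// [v in LHS]matrix_sum_delta.
rewrite linear_sum; apply: eq_bigr => i _.
rewrite big_ord1 linearZ/= mxE deriveE// [RHS]mulrC.
by [].
Qed.

Lemma is_derive_line a v (t : R) :
  is_derive t 1 (fun s => f (a + s *: v)) (dotp (grad f (a + t *: v)) v).
Proof.
have E : (fun h : R => h^-1 *:
      (((fun s => f (a + s *: v)) \o shift t) (h *: 1) - f (a + t *: v))) =
    (fun h : R => h^-1 *: ((f \o shift (a + t *: v)) (h *: v) - f (a + t *: v))).
  apply/funext => h /=; congr (_ *: (f _ - _)).
  by rewrite [h%:A]mulr1 scalerDl addrCA.
split; first by rewrite /derivable E; apply: diff_derivable.
by rewrite /derive E -derive_grad.
Qed.

Lemma line_continuous a v : continuous (fun s : R => f (a + s *: v)).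
Proof.
move=> t; apply: differentiable_continuous; apply/derivable1_diffP.
by case: (is_derive_line a v t).
Qed.

Lemma strongly_monotone_grad_line m a v (t : R) :
  strongly_monotone_grad m f -> 0 < t ->
  dotp (grad f a) v + m * t * dotp v v <= dotp (grad f (a + t *: v)) v.
Proof.
move=> fm t0; have := fm (a + t *: v) a.
rewrite norm2_sqr addrAC subrr add0r !dotp_lin => h.
by rewrite -(ler_pM2l t0); lra.
Qed.

(** The mean value theorem on the two halves of the segment replaces integration: on the second half
    the slope exceeds the initial one by at least [m / 2 * dotp v v], whence the factor [m / 4]. *)
Lemma strongly_monotone_grad_lower m a b :
  0 <= m -> strongly_monotone_grad m f ->
  f a + dotp (grad f a) (b - a) + m / 4 * dotp (b - a) (b - a) <= f b.
Proof.
move=> m0 fm; set v := b - a.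
have mvt (s t : R) : s < t -> 0 <= s ->
    (dotp (grad f a) v + m * s * dotp v v) * (t - s) <=
    f (a + t *: v) - f (a + s *: v).
  move=> st s0.
  have [|c] := MVT st (fun x _ => is_derive_line a v x).
    exact/continuous_subspaceT/line_continuous.
  rewrite in_itv/= => /andP[sc ct] ->.
  rewrite ler_pM2r ?subr_gt0//.
  apply: le_trans (strongly_monotone_grad_line _ _ fm _); last exact: le_lt_trans sc.
  by rewrite lerD2l ler_wpM2r ?dotp_ge0// ler_wpM2l// ltW.
have h2 : (0 : R) < 2^-1 by lra.
have h1 : (2^-1 : R) < 1 by lra.
have := mvt _ _ h2 (lexx _); have := mvt _ _ h1 (ltW h2).
rewrite scale0r scale1r addr0 [a + v]addrC subrK.
by lra.
Qed.

(** Along each line through [x] in a direction of the kernel, [f] is minimal at parameter 0, so its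
    derivative vanishes there. *)
Lemma grad_ortho_ker k (P : 'M[R]_(k, n)) x :
  P *m x = 0 -> (forall y, P *m y = 0 -> f x <= f y) ->
  forall v, P *m v = 0 -> dotp (grad f x) v = 0.
Proof.
move=> Px xmin v Pv.
have d0 : is_derive (0 : R) 1 (fun s => f (x + s *: v)) 0.
  apply: (@derive1_at_min _ _ (-1) 1).
  - by lra.
  - by move=> t _; case: (is_derive_line x v t).
  - by rewrite in_itv/=; apply/andP; split; lra.
  - move=> t _; rewrite scale0r addr0; apply: xmin.
    by rewrite mulmxDr -scalemxAr Px Pv scaler0 addr0.
have := is_derive_line x v 0; rewrite scale0r addr0 => d1.
by rewrite -(@derive_val _ _ _ _ _ _ _ d1) (@derive_val _ _ _ _ _ _ _ d0).
Qed.

(** Quadratic growth gives [f y >= f 0] outside a ball, so a minimizer over the part of the kernel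
    inside that ball is global. *)
Lemma strongly_monotone_grad_min_ker k (P : 'M[R]_(k, n)) m :
  0 < m -> strongly_monotone_grad m f ->
  exists2 x, P *m x = 0 & forall y, P *m y = 0 -> f x <= f y.
Proof.
move=> m0 fm.
have cf : continuous f by move=> x; exact: differentiable_continuous.
(* With this [r], [m / 4 * r] is [(m / 4)^-1 |g|^2], the price of absorbing the linear term by
   Young's inequality. *)
pose g := grad f 0; pose r := 16 / m ^+ 2 * dotp g g.
have out y : r < dotp y y -> f 0 <= f y.
  move=> ry; have := strongly_monotone_grad_lower 0 y (ltW m0) fm.
  rewrite subr0 -/g; apply: le_trans.
  have m4 : 0 < m / 4 by rewrite divr_gt0.
  have := dotp_young (- g) y (t := (m / 4)^-1); rewrite invr_gt0 => /(_ m4).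
  have : (m / 4)^-1 * dotp g g = m / 4 * r by rewrite /r; field; rewrite gt_eqF.
  rewrite invrK !dotp_lin => h.
  have : m / 4 * r < m / 4 * dotp y y by rewrite ltr_pM2l.
  by lra.
have r0 : 0 <= r by rewrite mulr_ge0 ?dotp_ge0// divr_ge0// sqr_ge0.
pose A := [set x : 'cV[R]_n | P *m x = 0] `&` [set x | dotp x x <= r].
have [|||x [Px _] xmin] := @compact_EVT_min_cV _ _ f A r cf.
- apply: closedI; first exact: closed_ker.
  apply: (@preimage_closed _ _ (fun x : 'cV[R]_n => dotp x x) [set t | t <= r]).
    by move=> x _; exact: dotp_continuous.
  exact: closed_le.
- by exists 0; split; rewrite /= ?mulmx0 ?dotp0r.
- by move=> x [].
exists x => // y Py; have [yr|/out] := leP (dotp y y) r; first exact: xmin.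
by apply: le_trans; apply: xmin; split; rewrite /= ?mulmx0 ?dotp0r.
Qed.

End Gradient.

(** * The separable objective: blockwise gradient and global constants *)

Section SeparableObjective.
Variables (R : realType) (L N : nat) (fi : 'I_L -> 'cV[R]_N -> R).
Hypothesis dfi : forall i x, differentiable (fi i) x.
Implicit Types x y v : blockV R L N.

Lemma mxsub_continuous m n m' n' (g : 'I_m' -> 'I_m) (h : 'I_n' -> 'I_n) :
  continuous (@mxsub R m n m' n' g h).
Proof.
move=> x s /= /nbhs_ballP[e e0 es].
apply/nbhs_ballP; exists e => // y [_ xy]; apply: es; split => // i j.
by rewrite !mxE.
Qed.

Lemma dotp_blocks x y : dotp x y = \sum_i dotp (submxcol x i) (submxcol y i).
Proof.
rewrite dotpE -{1}(submxcolK x) -{1}(submxcolK y) tr_mxcol mul_mxrow_mxcol.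
by rewrite summxE; apply: eq_bigr => i _; rewrite dotpE.
Qed.

Lemma sum_objE : sum_obj fi = \sum_i (fi i \o (fun x => submxcol x i)).
Proof. by apply/funext => x; rewrite fct_sumE. Qed.

Lemma differentiable_block i x :
  differentiable (fi i \o (fun x : blockV R L N => submxcol x i)) x.
Proof.
apply: differentiable_comp; last exact: dfi.
apply: (@linear_differentiable R _ _
  (@mxsub R _ _ _ _ (@tagnat.Rank L (fun=> N) i) (@id 'I_1))).
exact: mxsub_continuous.
Qed.

Lemma differentiable_sum_obj x : differentiable (sum_obj fi) x.
Proof.
by rewrite sum_objE; apply: differentiable_sum => i; exact: differentiable_block.
Qed.

(** A directional derivative of the sum is the sum of the block derivatives, and a vector is
    determined by its products with all directions. *)
Lemma grad_sum_obj x i :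
  submxcol (grad (sum_obj fi) x) i = grad (fi i) (submxcol x i).
Proof.
suff -> : grad (sum_obj fi) x = \mxcol_i grad (fi i) (submxcol x i).
  by rewrite mxcolK.
apply: dotp_inj => v; rewrite -derive_grad; last exact: differentiable_sum_obj.
rewrite sum_objE derive_sum => [|j]; last first.
  exact/diff_derivable/differentiable_block.
rewrite dotp_blocks; apply: eq_bigr => j _; rewrite mxcolK -derive_grad//.
apply: (f_equal (fun F : R -> R => lim (F h @[h --> 0^'])));
  apply/funext => h /=.
by rewrite submxcolD; congr (_ *: (fi j (_ + _) - _)); apply/colP => k; rewrite !mxE.
Qed.

Lemma strongly_monotone_sum_obj (mfi : 'I_L -> R) :
  (forall i, 0 < mfi i) -> (forall i, strongly_monotone_grad (mfi i) (fi i)) ->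
  strongly_monotone_grad (inf (range mfi)) (sum_obj fi).
Proof.
move=> mfi0 fim x y; rewrite norm2_sqr !dotp_blocks mulr_sumr.
apply: ler_sum => i _; rewrite !submxcolB !grad_sum_obj.
apply: le_trans (fim _ _ _); rewrite norm2_sqr ler_wpM2r ?dotp_ge0//.
apply: ge_inf; last by exists i.
by exists 0 => _ [j _ <-]; exact: ltW.
Qed.

Lemma has_sup_range_ord (F : 'I_L -> R) : has_ubound (range F).
Proof.
exists (\sum_i `|F i|) => _ [i _ <-].
rewrite (bigD1 i)//= (le_trans (ler_norm _))// lerDl.
by apply: sumr_ge0.
Qed.

Lemma lipschitz_sum_obj (Mfi : 'I_L -> R) :
  (forall i, 0 < Mfi i) -> (forall i, lipschitz_grad (Mfi i) (fi i)) ->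
  lipschitz_grad (sup (range Mfi)) (sum_obj fi).
Proof.
move=> Mfi0 fil x y; set M := sup _.
have MfiM i : Mfi i <= M.
  by apply: ub_le_sup; [exact: has_sup_range_ord|exists i].
have M0 : 0 <= M.
  (* Without any block the range is empty and its [sup] has the default value 0. *)
  case: (pselect (exists i : 'I_L, True)) => [[i _]|L0].
    exact: le_trans (ltW (Mfi0 i)) (MfiM i).
  rewrite /M (_ : range Mfi = set0) ?sup0//.
  by apply/seteqP; split => // t [i _ _]; case: L0; exists i.
rewrite -(@ler_pXn2r _ 2) ?nnegrE ?mulr_ge0 ?sqrtr_ge0//.
rewrite exprMn !norm2_sqr !dotp_blocks mulr_sumr.
apply: ler_sum => i _; rewrite !submxcolB !grad_sum_obj.
apply: le_trans (dotp_le_sqr (fil _ _ _)) _.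
rewrite ler_wpM2r ?dotp_ge0// lerXn2r// nnegrE// ltW//.
Qed.

Lemma inf_range_ord_gt0 (mfi : 'I_L -> R) :
  (0 < L)%N -> (forall i, 0 < mfi i) -> 0 < inf (range mfi).
Proof.
move=> L0 mfi0; pose i0 := Ordinal L0.
have [i imin] : exists i, forall j, mfi i <= mfi j.
  exists [arg min_(i < i0) mfi i]%O.
  by case: Order.TotalTheory.arg_minP => // i _ imin j; exact: imin.
apply: lt_le_trans (mfi0 i) _; apply: lb_le_inf.
  by exists (mfi i0); exists i0.
by move=> s [j _ <-]; exact: imin.
Qed.

End SeparableObjective.

(** * Singular values as extrema of quadratic forms *)

Section SingularValues.
Variable R : realType.
Implicit Types m n : nat.

(** The form attains its minimum on the unit sphere of the kernel of [P], and a minimizer is an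
    eigenvector because [S] preserves that kernel. The choice [P = 0] serves [sigma_max]; a [P]
    whose kernel is a column space serves [sigma_min_nz]. *)
Lemma rayleigh_min n k (S : 'M[R]_n) (P : 'M[R]_(k, n)) :
  S^T = S -> (forall x : 'cV[R]_n, P *m x = 0 -> P *m (S *m x) = 0) ->
  (exists2 x : 'cV[R]_n, P *m x = 0 & x != 0) ->
  exists lam (x : 'cV[R]_n), [/\ P *m x = 0, x != 0, S *m x = lam *: x &
    forall y : 'cV[R]_n, P *m y = 0 -> lam * dotp y y <= dotp y (S *m y)].
Proof.
move=> Ssym SP [x0 Px0 x0n0].
pose A := [set x : 'cV[R]_n | P *m x = 0] `&` [set x | dotp x x = 1].
have unitv (y : 'cV[R]_n) : P *m y = 0 -> y != 0 ->
    A ((Num.sqrt (dotp y y))^-1 *: y).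
  move=> Py y0; split => /=; first by rewrite -scalemxAr Py scaler0.
  rewrite !dotp_lin mulrA -invfM -expr2 sqr_sqrtr ?dotp_ge0//.
  by rewrite mulVf// gt_eqF// dotp_gt0.
have [||||x [/= Px x1] xmin] :=
    @compact_EVT_min_cV _ _ (fun x => dotp x (S *m x)) A 1.
- exact: dotp_mulmx_continuous.
- apply: closedI; first exact: closed_ker.
  apply: (@preimage_closed _ _ (fun x : 'cV[R]_n => dotp x x) [set 1]).
    by move=> x _; exact: dotp_continuous.
  exact: closed_eq.
- by eexists; exact: unitv x0n0.
- by move=> x [_ /= ->].
set lam := dotp x (S *m x) in xmin.
have lamle y : P *m y = 0 -> lam * dotp y y <= dotp y (S *m y).
  move=> Py; have [->|y0] := eqVneq y 0; first by rewrite mulmx0 !dotp0r mulr0.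
  have := xmin _ (unitv _ Py y0).
  rewrite -scalemxAr !dotp_lin mulrA -invfM -expr2 sqr_sqrtr ?dotp_ge0//.
  by rewrite mulrC ler_pdivlMr ?dotp_gt0.
exists lam, x; split => //.
  by apply: contra_eq_neq x1 => ->; rewrite dotp0r eq_sym oner_eq0.
(* The form of [S - lam] is nonnegative on [ker P] and vanishes at [x], so
   [x] minimizes it along [x - t *: r]. *)
apply/eqP; rewrite -subr_eq0; apply/eqP.
have [r rE] : exists r, r = S *m x - lam *: x by eexists.
rewrite -rE.
have Pr : P *m r = 0 by rewrite rE mulmxBr SP// -scalemxAr Px scaler0 subr0.
apply: dotp_eq0; apply/eqP; rewrite eq_le dotp_ge0 andbT leNgt.
apply/negP => r0.
pose q := dotp r (S *m r) - lam * dotp r r.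
have q0 : 0 <= q by rewrite subr_ge0 lamle.
have xSr : dotp x (S *m r) = dotp r (S *m x) by rewrite -Ssym -dotp_mulmx dotpC Ssym.
have rr : dotp r r = dotp r (S *m x) - lam * dotp x r.
  by rewrite [X in dotp r X]rE !dotp_lin (dotpC r x).
have main t : 2 * t * dotp r r <= t ^+ 2 * q.
  have := lamle (x - t *: r).
  rewrite !mulmxBr -!scalemxAr Px Pr scaler0 subr0 => /(_ erefl).
  rewrite !dotp_lin x1 xSr (dotpC r x) -/lam => h.
  rewrite /q rr; nra.
have q1 : 0 < q + 1 by rewrite ltr_wpDl.
(* At this step length the linear term of [main] outweighs the quadratic one; [q + 1] keeps the
   denominator positive. *)
have := main (dotp r r / (q + 1)).
have := divr_gt0 r0 q1; have := divfK (lt0r_neq0 q1) (dotp r r).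
by move: (dotp r r / (q + 1)) => t <-; nra.
Qed.

Lemma singular_valueP m n (A : 'M[R]_(m, n)) (s : R) :
  singular_value A s <-> 0 <= s /\
    exists2 x : 'cV[R]_n, x != 0 & A^T *m A *m x = s ^+ 2 *: x.
Proof.
split=> -[s0 h]; split => //.
  have /eigenvalueP[v vA v0] := h.
  exists v^T; first by rewrite trmx_eq0.
  by rewrite -[A^T *m A]gramx_sym -trmx_mul vA linearZ.
have [x x0 Ax] := h.
apply/eigenvalueP; exists x^T; last by rewrite trmx_eq0.
by rewrite -[A^T *m A]gramx_sym -trmx_mul Ax linearZ.
Qed.

Lemma singular_value_sqrt m n (A : 'M[R]_(m, n)) lam (x : 'cV[R]_n) :
  x != 0 -> A^T *m A *m x = lam *: x ->
  [/\ 0 <= lam, singular_value A (Num.sqrt lam) &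
      lam * dotp x x = dotp (A *m x) (A *m x)].
Proof.
move=> x0 Ax; have E : lam * dotp x x = dotp (A *m x) (A *m x).
  by rewrite dotp_mulmx mulmxA Ax dotpZr.
have lam0 : 0 <= lam by rewrite -(pmulr_lge0 _ (dotp_gt0 x0)) E dotp_ge0.
split => //; apply/singular_valueP; split; first exact: sqrtr_ge0.
by exists x => //; rewrite sqr_sqrtr.
Qed.

Lemma singular_value_vec m n (A : 'M[R]_(m, n)) (s : R) :
  singular_value A s -> exists2 x : 'cV[R]_n, x != 0 &
    A^T *m A *m x = s ^+ 2 *: x /\ dotp (A *m x) (A *m x) = s ^+ 2 * dotp x x.
Proof.
move=> /singular_valueP[_ [x x0 Ax]]; exists x => //; split => //.
by rewrite dotp_mulmx mulmxA Ax dotpZr.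
Qed.

(** Minimizing the form of [- (A^T *m A)] yields the largest eigenvalue [- mu] of [A^T *m A]. It
    also bounds all singular values, so their [sup] is a genuine one. *)
Lemma sigma_max_bound m n (A : 'M[R]_(m, n)) (x : 'cV[R]_n) :
  dotp (A *m x) (A *m x) <= sigma_max A ^+ 2 * dotp x x.
Proof.
have [->|x0] := eqVneq x 0; first by rewrite mulmx0 !dotp0r mulr0.
pose S := - (A^T *m A).
have [|||mu [y [_ y0 Sy mumin]]] := @rayleigh_min n n S 0.
- by rewrite linearN/= gramx_sym.
- by move=> z _; rewrite mul0mx.
- by exists x => //; rewrite mul0mx.
have Ay : A^T *m A *m y = - mu *: y by rewrite scaleNr -Sy mulNmx opprK.
have bound z : dotp (A *m z) (A *m z) <= - mu * dotp z z.
  have := mumin z (mul0mx _ _).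
  by rewrite /S mulNmx dotpNr dotp_mulmx mulmxA; lra.
have [mu0 sv _] := singular_value_sqrt y0 Ay.
apply: le_trans (bound x) _; rewrite ler_wpM2r ?dotp_ge0//.
have le_sup : Num.sqrt (- mu) <= sigma_max A.
  apply: ub_le_sup => //; exists (Num.sqrt (- mu)) => s sA.
  have [z z0 [_ Az]] := singular_value_vec sA.
  rewrite -(@ler_pXn2r _ 2) ?nnegrE ?sqrtr_ge0//; last by case: sA.
  by rewrite sqr_sqrtr// -(ler_pM2r (dotp_gt0 z0)) -Az bound.
rewrite -[leLHS]sqr_sqrtr// lerXn2r ?nnegrE ?sqrtr_ge0//.
exact: le_trans (sqrtr_ge0 (- mu)) le_sup.
Qed.

(** For [x = A^T y] one has [|x|^2 = <y, A x>]. Young's inequality with weight [s] and the bound for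
    [A] give [2 |x|^2 <= s |y|^2 + |x|^2]. *)
Lemma sigma_max_bound_trmx m n (A : 'M[R]_(m, n)) (y : 'cV[R]_m) :
  dotp (A^T *m y) (A^T *m y) <= sigma_max A ^+ 2 * dotp y y.
Proof.
set x := A^T *m y; set s := sigma_max A ^+ 2.
have := sigma_max_bound A x; rewrite -/s => Ax.
have xE : dotp x x = dotp y (A *m x) by rewrite {1}/x dotp_mulmx trmxK.
have s0 : 0 <= s by exact: sqr_ge0.
have [->|x0] := eqVneq x 0; first by rewrite dotp0r mulr_ge0// dotp_ge0.
have xx := dotp_gt0 x0.
have {s0} s0 : 0 < s.
  rewrite lt0r s0 andbT; apply/negP => /eqP s00.
  move: Ax; rewrite s00 mul0r => Ax.
  have /dotp_eq0 Ax0 : dotp (A *m x) (A *m x) = 0.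
    by apply/eqP; rewrite eq_le Ax dotp_ge0.
  by move: xx; rewrite xE Ax0 dotp0r ltxx.
have := dotp_young y (A *m x) s0; rewrite -xE.
have : s^-1 * dotp (A *m x) (A *m x) <= dotp x x by rewrite ler_pdivrMl.
by lra.
Qed.

Lemma mulmx_neq0 m n (A : 'M[R]_(m, n)) :
  A != 0 -> exists x : 'cV[R]_n, A *m x != 0.
Proof.
move=> A0; apply/not_existsP => h; move/eqP: A0; apply; apply/matrixP => i j.
have /negP := h (delta_mx j 0); rewrite negbK => /eqP.
by rewrite -colE => /colP/(_ i); rewrite !mxE.
Qed.

Lemma sigma_max_neq0 m n (A : 'M[R]_(m, n)) : A != 0 -> sigma_max A != 0.
Proof.
move=> /mulmx_neq0[x Ax0]; apply/eqP => s0.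
have := sigma_max_bound A x; rewrite s0 expr0n mul0r.
by rewrite leNgt dotp_gt0.
Qed.

(** The rows of [kermx A^T] span the kernel of [A], so [x] is orthogonal to that kernel and the
    Fredholm alternative applies. *)
Lemma ker_kermx_trmx m n (A : 'M[R]_(m, n)) (x : 'cV[R]_n) :
  kermx A^T *m x = 0 -> exists w, x = A^T *m A *m w.
Proof.
move=> kx; apply: ortho_ker_colspace => v Av.
have /submxP[u uv] : (v^T <= kermx A^T)%MS.
  by apply/sub_kermxP; rewrite -trmx_mul Av trmx0.
by rewrite dotpC dotpE uv -mulmxA kx mulmx0 mxE.
Qed.

(** The kernel of [P] is the column space of [A^T], which meets the kernel of [A] only in 0, so the
    Rayleigh minimum on it is positive. Eigenvectors for nonzero singular values all lie there, so
    this minimum is the square of the smallest one. *)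
Lemma sigma_min_nzP m n (A : 'M[R]_(m, n)) : A != 0 ->
  0 < sigma_min_nz A /\
  forall v, in_colspace A^T v ->
    sigma_min_nz A ^+ 2 * dotp v v <= dotp (A *m v) (A *m v).
Proof.
move=> A0; pose P := kermx A^T.
have PA p (y : 'M[R]_(m, p)) : P *m (A^T *m y) = 0.
  by rewrite mulmxA mulmx_ker mul0mx.
have [|||lam [x [Px x0 Ax lamin]]] := @rayleigh_min n n (A^T *m A) P.
- exact: gramx_sym.
- by move=> y _; rewrite -mulmxA PA.
- have [|y y0] := @mulmx_neq0 _ _ A^T; first by rewrite trmx_eq0.
  by exists (A^T *m y).
have [lam0 sv lamE] := singular_value_sqrt x0 Ax.
have {}lam0 : 0 < lam.
  rewrite lt0r lam0 andbT; apply: contraNneq x0 => lam00.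
  have [w xw] := ker_kermx_trmx Px.
  move: lamE; rewrite lam00 mul0r => /esym/dotp_eq0.
  by rewrite xw -!mulmxA mulmxA -{1}[A]trmxK => /gramx_eq0 ->.
have sq0 : 0 < Num.sqrt lam by rewrite sqrtr_gt0.
have -> : sigma_min_nz A = Num.sqrt lam.
  apply/eqP; rewrite eq_le; apply/andP; split.
    apply: ge_inf; first by exists 0 => s [[]].
    by split => //; rewrite gt_eqF.
  apply: lb_le_inf; first by exists (Num.sqrt lam); split => //; rewrite gt_eqF.
  move=> s [sA s0]; have [z z0 [Az Az2]] := singular_value_vec sA.
  have Pz : P *m z = 0.
    rewrite -[z](scalerK (expf_neq0 2 s0)) -Az -mulmxA -scalemxAr.
    by rewrite PA scaler0.
  rewrite -(@ler_pXn2r _ 2) ?nnegrE ?sqrtr_ge0//; last by case: sA.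
  rewrite (sqr_sqrtr (ltW lam0)) -(ler_pM2r (dotp_gt0 z0)) -Az2.
  by rewrite dotp_mulmx mulmxA lamin.
split => // _ [w ->]; rewrite (sqr_sqrtr (ltW lam0)) [leRHS]dotp_mulmx mulmxA.
exact/lamin/PA.
Qed.

End SingularValues.

Local Ltac nonneg :=
  repeat first [done | exact: sqr_ge0 | exact: ltW | rewrite invr_ge0
               | apply: addr_ge0 | apply: mulr_ge0].

(** * Errors over one iteration: contraction and bounded expansion *)

Section ErrorStep.
Variables (R : realType) (n p : nat) (Mp Mm : 'M[R]_(n, p)) (c m M : R).
Hypotheses (c0 : 0 < c) (m0 : 0 < m).
Implicit Types (d g : 'cV[R]_n) (Z B : 'cV[R]_p).

(** The squared G-norm of the stacked vector [col_mx Z B]. *)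
Definition energy Z B : R := c * dotp Z Z + c^-1 * dotp B B.

Lemma energy_ge0 Z B : 0 <= energy Z B.
Proof. by rewrite addr_ge0// mulr_ge0 ?dotp_ge0// ?invr_ge0 ltW. Qed.

Lemma energy_eq0 Z B : energy Z B = 0 -> Z = 0 /\ B = 0.
Proof.
move/eqP; rewrite paddr_eq0; last 2 first.
- by rewrite mulr_ge0 ?dotp_ge0// ltW.
- by rewrite mulr_ge0 ?dotp_ge0// invr_ge0 ltW.
rewrite !mulf_eq0 invr_eq0 gt_eqF//= => /andP[/eqP Z0 /eqP B0].
by split; exact: dotp_eq0.
Qed.

(* [d], [g], [Z] and [B] stand for the errors of [x], of the gradient of [f],
   of [z] and of [beta]; the indices 0 and 1 are the iterations [k] and [k+1]. *)
Definition error_step d g Z0 Z1 B0 B1 : Prop :=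
  [/\ g + Mm *m B1 = c *: (Mp *m (Z0 - Z1)),
      Mp^T *m d = 2 *: Z1,
      Mm^T *m d = (2 / c) *: (B1 - B0),
      m * dotp d d <= dotp g d &
      dotp g g <= M ^+ 2 * dotp d d].

(** The equations turn [dotp g d] into products of [Z0 - Z1] with [Z1] and of [B1 - B0] with [B1];
    polarization rewrites these through squared norms. *)
Lemma energy_step d g Z0 Z1 B0 B1 : error_step d g Z0 Z1 B0 B1 ->
  energy Z1 B1 + energy (Z0 - Z1) (B0 - B1) + dotp g d = energy Z0 B0.
Proof.
case=> e1 e2 e3 _ _.
have -> : dotp g d = c * dotp (Z0 - Z1) (2 *: Z1)
                     - dotp B1 ((2 / c) *: (B1 - B0)).
  rewrite -e2 -e3 -!dotp_mulmx -dotpZl -e1 dotpDl.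
  by rewrite addrK.
rewrite /energy !dotp_lin (dotpC Z1 Z0) (dotpC B1 B0); field.
by rewrite gt_eqF.
Qed.

Lemma error_step_le d g Z0 Z1 B0 B1 : error_step d g Z0 Z1 B0 B1 ->
  m * dotp d d <= energy Z0 B0.
Proof.
move=> st; have := energy_step st; case: st => _ _ _ gd _.
by have := energy_ge0 Z1 B1; have := energy_ge0 (Z0 - Z1) (B0 - B1); lra.
Qed.

(** The two bounds on [dl] are the two members of the minimum in [delta], cleared of their
    denominators. *)
Lemma error_step_contraction mu dl d g Z0 Z1 B0 B1 :
  1 < mu -> 0 <= dl -> 0 < sigma_min_nz Mm ->
  (forall v, in_colspace Mm^T v ->
    sigma_min_nz Mm ^+ 2 * dotp v v <= dotp (Mm *m v) (Mm *m v)) ->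
  dl * (mu * sigma_max Mp ^+ 2) <= (mu - 1) * sigma_min_nz Mm ^+ 2 ->
  dl * (c / 4 * sigma_max Mp ^+ 2 + mu / c * M ^+ 2 * sigma_min_nz Mm ^- 2)
    <= m ->
  error_step d g Z0 Z1 B0 B1 -> in_colspace Mm^T B1 ->
  (1 + dl) * energy Z1 B1 <= energy Z0 B0.
Proof.
set s := sigma_min_nz Mm ^+ 2; set S := sigma_max Mp ^+ 2.
move=> mu1 dl0 smin0 sP dlS dlm st B1c.
have s0 : 0 < s by rewrite exprn_gt0.
have Een := energy_step st; case: st => e1 e2 e3 gd gg.
have z1 : 4 * dotp Z1 Z1 <= S * dotp d d.
  by have := sigma_max_bound_trmx Mp d; rewrite e2 !dotp_lin -/S; lra.
have zz := sigma_max_bound Mp (Z0 - Z1); rewrite -/S in zz.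
have bb := sP _ B1c.
set D := dotp d d in gd gg z1 *; set W := dotp (Z0 - Z1) (Z0 - Z1) in zz *.
set b := dotp B1 B1 in bb *.
have D0 : 0 <= D by exact: dotp_ge0.
have W0 : 0 <= W by exact: dotp_ge0.
have mu0 : 0 < mu by apply: lt_trans mu1.
(* Young's inequality with weight [mu] gives [|g + Mm B1|^2 >= (1 - 1/mu) |Mm B1|^2 - (mu - 1)
   |g|^2], whose left side is at most [c^2 S W]. *)
have main : (mu - 1) * s * b <= mu * (c ^+ 2 * S * W + (mu - 1) * M ^+ 2 * D).
  have h1 : c ^+ 2 * dotp (Mp *m (Z0 - Z1)) (Mp *m (Z0 - Z1)) =
      dotp (g + Mm *m B1) (g + Mm *m B1).
    by rewrite e1 !dotp_lin mulrA.
  have h2 : c ^+ 2 * dotp (Mp *m (Z0 - Z1)) (Mp *m (Z0 - Z1)) <= c ^+ 2 * (S * W).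
    by rewrite ler_wpM2l// sqr_ge0.
  have := dotp_young g (- (Mm *m B1)) mu0.
  rewrite h1 in h2; move: h2; rewrite !dotp_lin (dotpC (Mm *m B1) g).
  move: bb gg; set q := dotp (Mm *m B1) _; set G := dotp g g.
  move=> bb gg h2 h3.
  have h4 : mu * (2 * - dotp g (Mm *m B1)) <= mu ^+ 2 * G + q.
    rewrite -(ler_pM2l mu0) in h3; apply: le_trans h3 _.
    by rewrite mulrDr !opprK mulVKf ?gt_eqF// expr2 mulrA.
  have h5 : mu * (G + dotp g (Mm *m B1) + (dotp g (Mm *m B1) + q)) <=
      mu * (c ^+ 2 * (S * W)).
    by rewrite ler_pM2l.
  have h6 : mu * (mu - 1) * G <= mu * (mu - 1) * (M ^+ 2 * D).
    by rewrite ler_wpM2l// mulr_ge0 ?subr_ge0// ltW.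
  have h7 : (mu - 1) * (s * b) <= (mu - 1) * q.
    by rewrite ler_wpM2l// subr_ge0 ltW.
  by nra.
have b0 : 0 <= b by exact: dotp_ge0.
(* The two summands of the error of [u] are paid by [c W] and by [m D]. *)
suff : dl * (c * dotp Z1 Z1 + c^-1 * b) <= c * W + m * D.
  have : c * W <= energy (Z0 - Z1) (B0 - B1).
    by rewrite lerDl mulr_ge0 ?dotp_ge0// invr_ge0 ltW.
  by move: Een; rewrite {3}/energy -/b; rewrite /energy -/b; nra.
have hz : dl * (c * dotp Z1 Z1) <= dl * (c / 4 * S) * D.
  by rewrite -mulrA ler_wpM2l//; have := ler_wpM2l (ltW c0) z1; lra.
have hb : dl * (c^-1 * b) <= dl * (mu / c * M ^+ 2 * s^-1) * D + c * W.
  have k0 : 0 < (mu - 1) * s * c by rewrite !mulr_gt0// subr_gt0.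
  rewrite -(ler_pM2l k0).
  have -> : (mu - 1) * s * c * (dl * (c^-1 * b)) = dl * ((mu - 1) * s * b).
    by field; rewrite gt_eqF.
  apply: le_trans (ler_wpM2l dl0 main) _.
  have -> : (mu - 1) * s * c * (dl * (mu / c * M ^+ 2 * s^-1) * D + c * W) =
     dl * mu * (mu - 1) * M ^+ 2 * D + (mu - 1) * s * (c ^+ 2 * W).
    by field; rewrite !gt_eqF.
  (* The first bound on [dl] pays the [W] term; the second one pays both [D] terms at the end. *)
  have : dl * (mu * S) * (c ^+ 2 * W) <= (mu - 1) * s * (c ^+ 2 * W).
    by rewrite ler_wpM2r// mulr_ge0// sqr_ge0.
  by lra.
have := ler_wpM2r D0 dlm; rewrite -/s.
by lra.
Qed.

(* No iteration can gain more than a fixed factor, so the error ratios are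
   bounded away from 0. *)
Lemma error_step_expansion : Mp != 0 ->
  exists2 K, 0 < K & forall d g Z0 Z1 B0 B1,
    error_step d g Z0 Z1 B0 B1 -> in_colspace Mp^T (Z0 - Z1) ->
    energy Z0 B0 <= K * energy Z1 B1.
Proof.
move=> Mp0.
have [sp0 spP] := sigma_min_nzP Mp0.
have [|st0 stP] := @sigma_min_nzP _ _ _ Mp^T; first by rewrite trmx_eq0.
rewrite trmxK in stP.
set s := sigma_min_nz Mp ^+ 2 in spP; set s' := sigma_min_nz Mp^T ^+ 2 in stP.
have s0 : 0 < s by rewrite exprn_gt0.
have s'0 : 0 < s' by rewrite exprn_gt0.
pose S := sigma_max Mm ^+ 2.
have S0 : 0 <= S by exact: sqr_ge0.
have M0 : 0 <= M ^+ 2 by exact: sqr_ge0.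
(* [t] is small enough for [t |g|^2 <= m/2 |d|^2]. Relative to the new energy, [K1] to [K4] bound
   [|d|^2], [|B0|^2], [|Z0 - Z1|^2] and [|Z0|^2]. *)
pose t := m / (2 * (M ^+ 2 + 1)).
have t0 : 0 < t by rewrite divr_gt0// mulr_gt0// ltr_wpDl.
pose K1 := m^-1 * (t^-1 * (4 / s' * c^-1) + 2 / m * (S * c)).
have K10 : 0 <= K1 by rewrite /K1; nonneg.
pose K2 := 2 * c + 2 * (c / 2) ^+ 2 * (S * K1).
have K20 : 0 < K2 by rewrite ltr_wpDr ?mulr_gt0//; nonneg.
pose K3 := (s * c ^+ 2)^-1 * (2 * (M ^+ 2 * K1) + 2 * (S * c)).
have K30 : 0 <= K3 by rewrite /K3; nonneg.
pose K4 := 2 * c^-1 + 2 * K3.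
have K40 : 0 < K4 by rewrite ltr_wpDr ?mulr_gt0 ?invr_gt0//; nonneg.
exists (c * K4 + c^-1 * K2); first by rewrite addr_gt0// mulr_gt0// invr_gt0.
move=> d g Z0 Z1 B0 B1 [e1 e2 e3 gd gg] Zc.
set V := energy Z1 B1.
have V0 : 0 <= V by exact: energy_ge0.
have Z1V : dotp Z1 Z1 <= c^-1 * V.
  rewrite -(ler_pM2l c0) mulVKf ?gt_eqF// lerDl mulr_ge0 ?dotp_ge0//.
  by rewrite invr_ge0 ltW.
have B1V : dotp B1 B1 <= c * V.
  rewrite -ler_pdivrMl// lerDr mulr_ge0 ?dotp_ge0//.
  exact: ltW.
have MB : dotp (Mm *m B1) (Mm *m B1) <= S * c * V.
  apply: le_trans (sigma_max_bound Mm B1) _; rewrite -/S -mulrA.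
  exact: ler_wpM2l.
have DV : dotp d d <= K1 * V.
  (* Orthogonal splitting of [d]: the part in the column space of [Mp] is controlled by
     [Mp^T d = 2 Z1], the part [q] in the kernel of [Mp^T] by strong monotonicity and the first
     equation. *)
  have [w dw] : exists w, Mp^T *m d = Mp^T *m Mp *m w.
    apply: ortho_ker_colspace => v Mv.
    by rewrite dotp_mulmx_trmx Mv dotp0r.
  have [q dq] : exists q, d = Mp *m w + q.
    by exists (d - Mp *m w); rewrite addrC subrK.
  have q0 : Mp^T *m q = 0.
    apply: (addrI (Mp^T *m d)); rewrite addr0 [in RHS]dq mulmxDr mulmxA -dw.
    by [].
  have pq : dotp (Mp *m w) q = 0 by rewrite dotp_mulmx q0 dotp0r.
  have dd : dotp d d = dotp (Mp *m w) (Mp *m w) + dotp q q.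
    by rewrite dq !dotp_lin (dotpC q) pq addr0 add0r.
  have pV : dotp (Mp *m w) (Mp *m w) <= 4 / s' * c^-1 * V.
    have := stP _ (ex_intro _ w erefl); rewrite mulmxA -dw e2 !dotp_lin => h.
    rewrite -(ler_pM2l s'0); apply: le_trans h _.
    have -> : s' * (4 / s' * c^-1 * V) = 4 * (c^-1 * V) by field; rewrite !gt_eqF.
    lra.
  have gq : dotp g q = - dotp (Mm *m B1) q.
    apply/eqP; rewrite -addr_eq0 -dotpDl e1 dotpZl dotp_mulmx q0 dotp0r.
    by rewrite mulr0.
  (* Each weight costs at most [m/2 |d|^2], together half of the [2 m |d|^2] that [2 <g, d>]
     provides. *)
  have y1 := dotp_young g (Mp *m w) t0.
  have y2 := dotp_young q (- (Mm *m B1)) (divr_gt0 m0 (ltr0n R 2)).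
  have tG : t * dotp g g <= m / 2 * dotp d d.
    apply: le_trans (ler_wpM2l (ltW t0) gg) _.
    rewrite mulrA ler_wpM2r ?dotp_ge0// /t.
    rewrite mulrAC ler_pdivrMr ?mulr_gt0// ?ltr_wpDl//.
    have -> : m / 2 * (2 * (M ^+ 2 + 1)) = m * M ^+ 2 + m by field.
    by rewrite lerDl ltW.
  have tp : t^-1 * dotp (Mp *m w) (Mp *m w) <= t^-1 * (4 / s' * c^-1) * V.
    by rewrite -mulrA ler_wpM2l// ?invr_ge0 ltW.
  have mB : 2 / m * dotp (Mm *m B1) (Mm *m B1) <= 2 / m * (S * c) * V.
    by rewrite -[leRHS]mulrA ler_wpM2l// divr_ge0// ltW.
  have gdE : dotp g d = dotp g (Mp *m w) - dotp (Mm *m B1) q.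
    by rewrite dq dotpDr gq.
  have mqd : m / 2 * dotp q q <= m / 2 * dotp d d.
    by rewrite ler_wpM2l ?divr_ge0 ?(ltW m0)// dd lerDr dotp_ge0.
  move: y2; rewrite dotpNl !dotpNr opprK (dotpC q) invf_div => y2.
  rewrite -(ler_pM2l m0) /K1 !mulrA mulfV ?gt_eqF// mul1r.
  by move: mB tp; rewrite !mulrA mulrDl; lra.
have B0V : dotp B0 B0 <= K2 * V.
  have -> : B0 = B1 + (- (c / 2)) *: (Mm^T *m d).
    rewrite e3 scalerA (_ : - (c / 2) * (2 / c) = -1); last by field; rewrite gt_eqF.
    by rewrite scaleN1r opprB subrKC.
  apply: le_trans (dotp_addl_le _ _) _; rewrite !dotp_lin.
  have : dotp (Mm^T *m d) (Mm^T *m d) <= S * (K1 * V).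
    by apply: le_trans (sigma_max_bound_trmx Mm d) _; exact: ler_wpM2l.
  have := sqr_ge0 (c / 2); rewrite /K2.
  by nra.
have WV : dotp (Z0 - Z1) (Z0 - Z1) <= K3 * V.
  rewrite /K3 -[leRHS]mulrA ler_pdivlMl; last by rewrite mulr_gt0// exprn_gt0.
  rewrite mulrAC mulrC.
  apply: le_trans (ler_wpM2l (sqr_ge0 c) (spP _ Zc)) _.
  have -> : c ^+ 2 * dotp (Mp *m (Z0 - Z1)) (Mp *m (Z0 - Z1)) =
      dotp (g + Mm *m B1) (g + Mm *m B1).
    by rewrite e1 !dotp_lin mulrA.
  apply: le_trans (dotp_addl_le _ _) _.
  have : dotp g g <= M ^+ 2 * (K1 * V).
    by apply: le_trans gg _; exact: ler_wpM2l.
  by lra.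
have Z0V : dotp Z0 Z0 <= K4 * V.
  rewrite -[Z0](subrKC Z1); apply: le_trans (dotp_addl_le _ _) _.
  by rewrite /K4; lra.
rewrite {1}/energy mulrDl -!mulrA lerD//.
  by rewrite ler_pM2l.
by rewrite ler_pM2l// invr_gt0.
Qed.

End ErrorStep.

(** * Closure properties of column spaces *)

Section Colspace.
Variables (R : realType) (m n : nat) (A : 'M[R]_(m, n)).
Implicit Types v w : 'cV[R]_m.

Lemma in_colspaceD v w :
  in_colspace A v -> in_colspace A w -> in_colspace A (v + w).
Proof. by move=> [x ->] [y ->]; exists (x + y); rewrite mulmxDr. Qed.

Lemma in_colspaceZ a v : in_colspace A v -> in_colspace A (a *: v).
Proof. by move=> [x ->]; exists (a *: x); rewrite scalemxAr. Qed.

Lemma in_colspaceB v w :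
  in_colspace A v -> in_colspace A w -> in_colspace A (v - w).
Proof.
by move=> Av Aw; rewrite -scaleN1r; apply/in_colspaceD/in_colspaceZ.
Qed.

Lemma in_colspace_mul x : in_colspace A (A *m x).
Proof. by exists x. Qed.

End Colspace.

(** * KKT points of the network problem and the error system of the iteration *)

Section Network.
Variables (R : realType) (L E N : nat) (arc : 'I_(2 * E) -> 'I_L * 'I_L).
Local Notation A1 := (A1 R N arc).
Local Notation A2 := (A2 R N arc).
Local Notation Mp := (Mplus R N arc).
Local Notation Mm := (Mminus R N arc).
Variable f : blockV R L N -> R.

Lemma trmx_Mplus : Mp^T = A1 + A2.
Proof. by rewrite /Mplus linearD/= !trmxK. Qed.

Lemma trmx_Mminus : Mm^T = A1 - A2.
Proof. by rewrite /Mminus linearB/= !trmxK. Qed.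

(** Both sides express [A1 x = z = A2 x], the right one through the difference and the half sum. *)
Lemma feasibleP (x : blockV R L N) (z : blockV R (2 * E) N) :
  matA R N arc *m x + matB R E N *m z = 0 <->
  Mm^T *m x = 0 /\ 2^-1 *: (Mp^T *m x) - z = 0.
Proof.
have half (v : blockV R (2 * E) N) : 2^-1 *: (v + v) = v.
  rewrite scalerDr -scalerDl (_ : 2^-1 + 2^-1 = 1) ?scale1r//.
  by field.
rewrite /matA /matB !mul_col_mx add_col_mx trmx_Mplus trmx_Mminus.
rewrite mulmxBl mulmxDl !mulNmx !mul1mx; split.
  move/eqP; rewrite col_mx_eq0 !subr_eq0 => /andP[/eqP -> /eqP ->].
  by rewrite half !subrr.
move=> [/eqP]; rewrite subr_eq0 => /eqP ->.
rewrite half => ->.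
by rewrite col_mx0.
Qed.

Hypothesis df : forall x, differentiable f x.
Variable m : R.
Hypotheses (m0 : 0 < m) (fm : strongly_monotone_grad m f).

(** The gradient at [xs] lies in the column space of [Mm], hence is orthogonal to the kernel of
    [Mm^T], and the growth bound loses its linear term. The remaining square yields both optimality
    and uniqueness. *)
Lemma KKT_gap xs zs bs x : KKT arc f xs zs bs -> Mm^T *m x = 0 ->
  f xs + m / 4 * dotp (x - xs) (x - xs) <= f x.
Proof.
move=> [e1 e2 _] Mx.
have := strongly_monotone_grad_lower df xs x (ltW m0) fm.
rewrite (_ : grad f xs = - (Mm *m bs)); last by apply/eqP; rewrite -addr_eq0 e1.
by rewrite dotpNl dotp_mulmx mulmxBr Mx e2 subrr dotp0r oppr0 addr0.
Qed.

Lemma KKT_primal_optimal xs zs bs :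
  KKT arc f xs zs bs -> primal_optimal arc f xs zs.
Proof.
move=> kkt; split; first by apply/feasibleP; case: kkt.
move=> x z /feasibleP[Mx _]; apply: le_trans (KKT_gap kkt Mx).
by rewrite lerDl mulr_ge0 ?dotp_ge0// divr_ge0// ltW.
Qed.

Lemma KKT_primal_unique xs zs bs x z : KKT arc f xs zs bs ->
  primal_optimal arc f x z -> x = xs /\ z = zs.
Proof.
move=> kkt [/feasibleP[Mx xz] xmin].
have [/xmin fxs _] := KKT_primal_optimal kkt.
have xxs : x = xs.
  apply/eqP; rewrite -subr_eq0; apply/eqP/dotp_eq0.
  apply/eqP; rewrite eq_le dotp_ge0 andbT -(@pmulr_rle0 _ (m / 4)) ?divr_gt0//.
  by have := KKT_gap kkt Mx; lra.
by split=> //; case: kkt => _ _ /subr0_eq <-; move/subr0_eq: xz => <-; rewrite xxs.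
Qed.

(** The Fredholm alternative for [Mm^T] writes [- grad f xs] as [Mm Mm^T w], so the multiplier
    [Mm^T w] already lies in the required column space. *)
Lemma KKT_exists : exists xs zs bs,
  KKT arc f xs zs bs /\ in_colspace Mm^T bs.
Proof.
have [xs Mxs xsmin] := strongly_monotone_grad_min_ker df Mm^T m0 fm.
have [w gw] : exists w, - grad f xs = Mm^T^T *m Mm^T *m w.
  apply: ortho_ker_colspace => v Mv; rewrite dotpNl.
  by rewrite (grad_ortho_ker df Mxs xsmin Mv) oppr0.
exists xs, (2^-1 *: (Mp^T *m xs)), (Mm^T *m w); split; last by exists w.
split=> //; last by rewrite subrr.
by rewrite trmxK in gw; rewrite mulmxA -gw subrr.
Qed.

(** The difference of the multipliers lies in the column space of [Mm^T] and in the kernel of [Mm],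
    which are orthogonal. *)
Lemma KKT_multiplier_unique xs zs b b' :
  KKT arc f xs zs b -> KKT arc f xs zs b' ->
  in_colspace Mm^T b -> in_colspace Mm^T b' -> b = b'.
Proof.
move=> [e1 _ _] [e1' _ _] bc b'c.
have [w bw] := in_colspaceB bc b'c.
apply/eqP; rewrite -subr_eq0 bw; apply/eqP/gramx_eq0; rewrite trmxK.
by rewrite -mulmxA -bw mulmxBr (addrI _ (etrans e1 (esym e1'))) subrr.
Qed.

Lemma Mminus_neq0 q : (0 < N)%N -> (arc q).1 != (arc q).2 -> Mm != 0.
Proof.
move=> N0 q12; rewrite -trmx_eq0 trmx_Mminus subr_eq0.
apply/eqP => /(congr1 (fun A => submxblock A q (arc q).1)).
rewrite !mxblockK eqxx eq_sym (negbTE q12).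
move=> /matrixP/(_ (Ordinal N0) (Ordinal N0)); rewrite !mxE eqxx => /eqP.
by rewrite oner_eq0.
Qed.

Lemma Mplus_neq0 q : (0 < N)%N -> (arc q).1 != (arc q).2 -> Mp != 0.
Proof.
move=> N0 q12; rewrite -trmx_eq0 trmx_Mplus addr_eq0.
apply/eqP => /(congr1 (fun A => submxblock A q (arc q).1)).
rewrite submxblockN !mxblockK eqxx eq_sym (negbTE q12).
move=> /matrixP/(_ (Ordinal N0) (Ordinal N0)); rewrite !mxE eqxx oppr0 => /eqP.
by rewrite oner_eq0.
Qed.

Lemma exists_proper_arc (e : rel 'I_L) : (2 <= L)%N -> irreflexive e ->
  (forall i j, connect e i j) -> arc_enumeration e arc ->
  exists q, (arc q).1 != (arc q).2.
Proof.
move=> L2 e_irr e_conn [_ harc].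
have L1 : (0 < L)%N by exact: ltnW.
have /connectP[[//|i p /= /andP[e0i _] _]] :=
  e_conn (Ordinal L1) (Ordinal L2).
have [q aq] := (harc _ _).1 e0i; exists q; rewrite aq/=.
by apply: contraTneq e0i => ->; rewrite e_irr.
Qed.

Section Iteration.
Variables (c M : R) (x : nat -> blockV R L N) (z beta : nat -> blockV R (2 * E) N).
Hypotheses (c0 : 0 < c) (fl : lipschitz_grad M f).
Hypothesis admm : ADMM arc f c x z beta.
Hypothesis beta0 : in_colspace Mm^T (beta 0%N).
Variables (xs : blockV R L N) (zs bs : blockV R (2 * E) N).
Hypothesis kkt : KKT arc f xs zs bs.

Lemma ADMM_error_step k :
  error_step Mp Mm c m M (x k.+1 - xs) (grad f (x k.+1) - grad f xs)
    (z k - zs) (z k.+1 - zs) (beta k - bs) (beta k.+1 - bs).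
Proof.
have [a1 a2 _] := admm k; have [_ _ a3] := admm k.+1; have [k1 k2 k3] := kkt.
have dB (v u w : blockV R (2 * E) N) : v - w - (u - w) = v - u.
  by rewrite opprB addrA subrK.
split.
- rewrite dB mulmxBr addrACA -opprD k1 subr0.
  exact: subr0_eq.
- move/subr0_eq: a3 => <-; move/subr0_eq: k3 => <-.
  by rewrite -scalerBr scalerA mulfV// scale1r mulmxBr.
- rewrite dB (subr0_eq a2).
  rewrite scalerA mulmxBr k2 subr0 (_ : 2 / c * (c / 2) = 1) ?scale1r//.
  by field; rewrite gt_eqF.
- by have := fm (x k.+1) xs; rewrite norm2_sqr.
- exact/dotp_le_sqr/fl.
Qed.

Lemma ADMM_multiplier_colspace k : in_colspace Mm^T (beta k).
Proof.
elim: k => // k IH; have [_ /subr0_eq/eqP + _] := admm k.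
rewrite subr_eq => /eqP ->.
by apply: in_colspaceD => //; exact/in_colspaceZ/in_colspace_mul.
Qed.

(** The relation [z k = 1/2 Mp^T x k] holds from index 0 on, so even the first increment
    qualifies. *)
Lemma ADMM_auxiliary_colspace k : in_colspace Mp^T (z k - zs - (z k.+1 - zs)).
Proof.
have [_ _ /subr0_eq a] := admm k; have [_ _ /subr0_eq a'] := admm k.+1.
rewrite opprB addrA subrK -a -a'.
by apply: in_colspaceB; exact/in_colspaceZ/in_colspace_mul.
Qed.

End Iteration.
End Network.

(** * From squared contraction to Q-linear and R-linear rates *)

Lemma Gnorm_sqr (R : realType) n (c : R) (Z B : 'cV[R]_n) : 0 < c ->
  Gnorm c (col_mx Z B) ^+ 2 = energy c Z B.
Proof.
move=> c0; have E : ((col_mx Z B)^T *m block_mx c%:M 0 0 (c^-1)%:M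
    *m col_mx Z B) 0 0 = energy c Z B.
  rewrite tr_col_mx mul_row_block !mulmx0 addr0 add0r mul_row_col.
  rewrite !mul_mx_scalar -!scalemxAl mxE.
  by rewrite [X in X + _]mxE [X in _ + X]mxE -!dotpE.
by rewrite /Gnorm E sqr_sqrtr// energy_ge0.
Qed.

(** The dominating sequence is the scalar [C * rho ^+ k], stored as a 1 by 1 matrix; its error ratio
    is constantly [rho], whatever the ratios of the iterates do. *)
Lemma geometric_R_linear (R : realType) n (x : nat -> 'cV[R]_n) (xs : 'cV[R]_n)
    (C rho : R) : 0 < rho < 1 -> 0 < C ->
  (forall k, norm2 (x k - xs) <= C * rho ^+ k) -> R_linear (@norm2 R n) x xs.
Proof.
move=> /andP[rho0 rho1] C0 xC.
exists 1%N, (fun u => `|u 0 0|), (fun k => (C * rho ^+ k)%:M), 0.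
have yE k : `|((C * rho ^+ k)%:M - 0 : 'cV[R]_1) 0 0| = C * rho ^+ k.
  by rewrite subr0 mxE eqxx mulr1n ger0_norm// mulr_ge0 ?exprn_ge0// ltW.
split.
- split=> [u v|a u|u /normr0_eq0 u0]; rewrite ?mxE ?ler_normD ?normrM//.
  by apply/matrixP => i j; rewrite !ord1 u0 mxE.
- exists rho; first by rewrite rho0.
  rewrite (_ : err_ratio _ _ _ = fun=> rho); first exact: cvg_cst.
  apply/funext => k; rewrite /err_ratio !yE exprS; field.
  by rewrite !gt_eqF// exprn_gt0.
- by move=> k; rewrite yE.
Qed.

Lemma delta_gt0 (R : realType) (L E N : nat) (arc : 'I_(2 * E) -> 'I_L * 'I_L)
    (c mu m M : R) :
  0 < c -> 1 < mu -> 0 < m ->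
  0 < sigma_min_nz (Mminus R N arc) -> sigma_max (Mplus R N arc) != 0 ->
  [/\ 0 < delta N arc c mu m M,
      delta N arc c mu m M * (mu * sigma_max (Mplus R N arc) ^+ 2)
        <= (mu - 1) * sigma_min_nz (Mminus R N arc) ^+ 2 &
      delta N arc c mu m M * (c / 4 * sigma_max (Mplus R N arc) ^+ 2
        + mu / c * M ^+ 2 * sigma_min_nz (Mminus R N arc) ^- 2) <= m].
Proof.
move=> c0 mu1 m0 s0 S0; rewrite /delta.
set s := sigma_min_nz _ ^+ 2; set S := sigma_max _ ^+ 2.
have {}s0 : 0 < s by rewrite exprn_gt0.
have {}S0 : 0 < S by rewrite lt0r sqr_ge0 andbT expf_neq0.
have mu0 : 0 < mu by exact: lt_trans mu1.
have muS : 0 < mu * S by rewrite mulr_gt0.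
have den : 0 < c / 4 * S + mu / c * M ^+ 2 * s^-1.
  by rewrite ltr_wpDr ?(mulr_gt0 (divr_gt0 c0 _) S0)//; nonneg.
split.
- by rewrite lt_min !divr_gt0// mulr_gt0// subr_gt0.
- by rewrite -ler_pdivlMr// ge_min lexx.
- by rewrite -ler_pdivlMr// ge_min lexx orbT.
Qed.

Lemma sqrt_inv_itv (R : realType) (dl : R) :
  0 < dl -> 0 < Num.sqrt (1 + dl)^-1 < 1.
Proof.
move=> dl0; have dl1 : 0 < 1 + dl by rewrite addr_gt0.
rewrite sqrtr_gt0 invr_gt0 dl1/= -[ltRHS]sqrtr1 ltr_sqrt// invf_lt1//.
by rewrite ltrDl.
Qed.

Section Rates.
Variables (R : realType) (n : nat) (nu : 'cV[R]_n -> R).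
Variables (y : nat -> 'cV[R]_n) (ys : 'cV[R]_n) (rho : R).
Hypotheses (nu_ge0 : forall u, 0 <= nu u) (rho01 : 0 < rho < 1).
Hypothesis contr : forall k, nu (y k.+1 - ys) <= rho * nu (y k - ys).

Lemma contraction_geometric k : nu (y k - ys) <= nu (y 0%N - ys) * rho ^+ k.
Proof.
have /andP[rho0 _] := rho01.
elim: k => [|k IH]; first by rewrite expr0 mulr1.
apply: le_trans (contr k) _; rewrite exprSr mulrA mulrC.
by rewrite ler_pM2r.
Qed.

(** The ratios stay between [K^-1] and [rho], and so does their limit. The expansion bound also
    keeps the errors positive, so no ratio divides by 0. *)
Lemma contraction_Q_linear (K : R) : 0 < K -> 0 < nu (y 0%N - ys) ->
  (forall k, nu (y k - ys) <= K * nu (y k.+1 - ys)) ->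
  cvg (err_ratio nu y ys @ \oo) -> Q_linear nu y ys.
Proof.
move=> K0 y0 expan cv; have /andP[rho0 rho1] := rho01.
have pos k : 0 < nu (y k - ys).
  elim: k => // k IH; rewrite -(pmulr_rgt0 _ K0).
  exact: lt_le_trans (expan k).
exists (lim (err_ratio nu y ys @ \oo)) => //; apply/andP; split.
  apply: (@lt_le_trans _ _ K^-1); first by rewrite invr_gt0.
  apply: limr_ge => //; apply: nearW => k.
  by rewrite /err_ratio ler_pdivlMr// ler_pdivrMl.
apply: le_lt_trans rho1; apply: limr_le => //; apply: nearW => k.
by rewrite /err_ratio ler_pdivrMr.
Qed.

End Rates.

Theorem theorem1 (R : realType) (L E N : nat) (hL : (2 <= L)%N)
  (hN : (1 <= N)%N)
  (e : rel 'I_L) (e_sym : symmetric e) (e_irr : irreflexive e)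
  (e_conn : forall i j, connect e i j)
  (arc : 'I_(2 * E) -> 'I_L * 'I_L) (harc : arc_enumeration e arc)
  (fi : 'I_L -> 'cV[R]_N -> R) (mfi Mfi : 'I_L -> R)
  (fi_diff : forall i x, differentiable (fi i) x)
  (mfi_gt0 : forall i, 0 < mfi i)
  (fi_mono : forall i, strongly_monotone_grad (mfi i) (fi i))
  (Mfi_gt0 : forall i, 0 < Mfi i)
  (fi_lip : forall i, lipschitz_grad (Mfi i) (fi i)) :
  let f := sum_obj fi in
  let mf := inf (range mfi) in
  let Mf := sup (range Mfi) in
  exists (xs : blockV R L N) (zs bs : blockV R (2 * E) N),
    [/\ primal_optimal arc f xs zs,
        forall x z, primal_optimal arc f x z -> x = xs /\ z = zs,
        KKT arc f xs zs bs /\ in_colspace (Mminus R N arc)^T bs,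
        forall b, KKT arc f xs zs b -> in_colspace (Mminus R N arc)^T b ->
          b = bs &
        forall (c : R) (x : nat -> blockV R L N)
          (z beta : nat -> blockV R (2 * E) N),
          0 < c ->
          ADMM arc f c x z beta ->
          in_colspace (Mminus R N arc)^T (beta 0%N) ->
          let u := fun k => col_mx (z k) (beta k) in
          let us := col_mx zs bs in
          forall mu : R, 1 < mu ->
          let dl := delta N arc c mu mf Mf in
          [/\ 0 < dl,
              forall k, Gnorm c (u k.+1 - us) ^+ 2
                        <= (1 + dl)^-1 * Gnorm c (u k - us) ^+ 2,
              Q_linear_bound (Gnorm c) u us /\
              (u 0%N <> us -> cvg (err_ratio (Gnorm c) u us @ \oo) ->
               Q_linear (Gnorm c) u us),
              R_linear (@norm2 R _) x xs &
              forall k, norm2 (x k.+1 - xs) ^+ 2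
                        <= mf^-1 * Gnorm c (u k - us) ^+ 2]].
Proof.
move=> f mf Mf.
have df x : differentiable f x by exact: differentiable_sum_obj.
have mf0 : 0 < mf by apply: inf_range_ord_gt0 => //; exact: ltnW.
have fm : strongly_monotone_grad mf f by exact: strongly_monotone_sum_obj.
have fl : lipschitz_grad Mf f by exact: lipschitz_sum_obj.
have [q q12] := exists_proper_arc hL e_irr e_conn harc.
have Mm0 := @Mminus_neq0 R _ _ N _ _ hN q12.
have Mp0 := @Mplus_neq0 R _ _ N _ _ hN q12.
have [smin0 sminP] := sigma_min_nzP Mm0.
have Smax0 := sigma_max_neq0 Mp0.
have [xs [zs [bs [kkt bsc]]]] := KKT_exists arc df mf0 fm.
exists xs, zs, bs; split => //.
- exact: KKT_primal_optimal df _ mf0 fm _ _ _ kkt.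
- by move=> x z; apply: (KKT_primal_unique df mf0 fm kkt).
- by move=> b kb bc; exact: KKT_multiplier_unique kb kkt bc bsc.
move=> c x z beta c0 admm beta0 u us mu mu1 dl.
have [dl0 dlS dlm] := delta_gt0 Mf c0 mu1 mf0 smin0 Smax0.
rewrite -/dl in dl0 dlS dlm.
pose en k := energy c (z k - zs) (beta k - bs).
have uE k : u k - us = col_mx (z k - zs) (beta k - bs).
  by rewrite opp_col_mx add_col_mx.
have GE k : Gnorm c (u k - us) ^+ 2 = en k by rewrite uE Gnorm_sqr.
have st := ADMM_error_step fm c0 fl admm kkt.
have dl1 : 0 < 1 + dl by rewrite addr_gt0.
have contr k : Gnorm c (u k.+1 - us) ^+ 2 <= (1 + dl)^-1 * Gnorm c (u k - us) ^+ 2.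
  rewrite !GE ler_pdivlMl//.
  apply: (error_step_contraction c0 mu1 (ltW dl0) smin0 sminP dlS dlm (st k)).
  by apply: in_colspaceB => //; exact: ADMM_multiplier_colspace admm beta0 _.
pose rho := Num.sqrt (1 + dl)^-1.
have rho01 : 0 < rho < 1 by exact: sqrt_inv_itv.
have /andP[rho0 rho1] := rho01.
have rho2 : rho ^+ 2 = (1 + dl)^-1 by rewrite sqr_sqrtr// invr_ge0 ltW.
have nu0 v : 0 <= Gnorm c v by exact: sqrtr_ge0.
have contr1 k : Gnorm c (u k.+1 - us) <= rho * Gnorm c (u k - us).
  rewrite -(@ler_pXn2r _ 2) ?nnegrE ?mulr_ge0 ?(ltW rho0)//.
  by rewrite exprMn rho2.
have xE k : norm2 (x k.+1 - xs) ^+ 2 <= mf^-1 * Gnorm c (u k - us) ^+ 2.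
  rewrite GE ler_pdivlMl// norm2_sqr.
  exact: error_step_le c0 _ _ _ _ _ _ (st k).
split=> //.
- split; first by exists rho.
  move=> u0 cv.
  have [K K0 KP] := error_step_expansion (Mminus R N arc) Mf c0 mf0 Mp0.
  have sK0 : 0 < Num.sqrt K by rewrite sqrtr_gt0.
  apply: (contraction_Q_linear rho01 contr1 sK0) => //.
    rewrite lt0r nu0 andbT; apply: contra_not_neq u0 => n0.
    have /(energy_eq0 c0)[] : en 0%N = 0 by rewrite -GE n0 expr0n.
    by rewrite /u /us => /subr0_eq -> /subr0_eq ->.
  move=> k; rewrite -(@ler_pXn2r _ 2) ?nnegrE ?mulr_ge0 ?(ltW sK0)//.
  rewrite exprMn (sqr_sqrtr (ltW K0)) !GE; apply: KP (st k) _.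
  exact: ADMM_auxiliary_colspace admm _ _.
(* The error of [x k.+1] is bounded by that of [u k], and the division by [rho] makes up for this
   shift. [C] adds the error of [x 0], which that bound does not reach, and 1 for positivity. *)
- pose a := Num.sqrt mf^-1 * Gnorm c (u 0%N - us) / rho.
  pose C := norm2 (x 0%N - xs) + a + 1.
  have a0 : 0 <= a by rewrite divr_ge0 ?mulr_ge0 ?sqrtr_ge0 ?(ltW rho0).
  have x00 : 0 <= norm2 (x 0%N - xs) by exact: sqrtr_ge0.
  apply: (@geometric_R_linear _ _ _ _ C rho rho01).
    by rewrite ltr_wpDl// addr_ge0.
  case=> [|k]; first by rewrite expr0 mulr1 /C; lra.
  apply: (@le_trans _ _ (a * rho ^+ k.+1)); last first.
    by apply: ler_wpM2r; [exact/exprn_ge0/ltW|rewrite /C; lra].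
  rewrite /a exprS mulrA divfK ?gt_eqF//.
  apply: (@le_trans _ _ (Num.sqrt mf^-1 * Gnorm c (u k - us))).
    rewrite -(@ler_pXn2r _ 2) ?nnegrE ?mulr_ge0 ?sqrtr_ge0//.
    by rewrite exprMn (@sqr_sqrtr _ mf^-1) ?invr_ge0 ?(ltW mf0).
  rewrite -mulrA ler_wpM2l ?sqrtr_ge0//.
  exact: contraction_geometric rho01 contr1 k.
Qed.
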